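(* Let $\mathcal{I}$ be an inference system over a set $\mathcal{S}$ of propositions such that: $\mathcal{I}$ is finite in conclusions and has a complement $\mathcal{J}$; $\mathcal{I}$ is equivalent to an automaton $\mathcal{A}$ (with respect to some well-founded order $\prec$ on $\mathcal{S}$); and $\mathcal{A}$ has a complement $\mathcal{B}$. Then for every proposition $A$: the sequent $\vdash A$ has a finite proof in $\mathcal{I}_{\mathcal{J}}$ if and only if it has a finite proof in $\mathcal{A}_{\mathcal{B}}$; and the sequent $\not\vdash A$ has a (possibly infinite) proof in $\mathcal{I}_{\mathcal{J}}$ if and only if it has a finite proof in $\mathcal{A}_{\mathcal{B}}$.
   Context: Let $\mathcal{S}$ be a set of propositions. An inference rule is a partial function $f$ from $\mathcal{S}^n$ to $\mathcal{S}$ for some $n\ge 0$; $B$ is derivable from $\langle A_1,\dots,A_n\rangle$ with $f$ if this tuple is in the domain of $f$ and $f(A_1,\dots,A_n)=B$. An inference system is a set of inference rules; it is finite in conclusions if each proposition is derivable with a rule of the system from only finitely many sequences. A (possibly infinite) proof in a system is a (possibly infinite) tree labeled with propositions such that each node labeled $B$ with children labeled $A_1,\dots,A_n$ has $B$ derivable from $\langle A_1,\dots,A_n\rangle$ with a rule of the system; it is a proof of its root label; a finite proof is a finite such tree. Two inference systems are equivalent if the same propositions have finite proofs in them. Complement: for $\mathcal{I}$ finite in conclusions, a system $\mathcal{J}$ is a complement of $\mathcal{I}$ if $\mathcal{J}$ is finite in conclusions and for each $B$, if $\langle A^1_1,\dots,A^1_{n_1}\rangle,\dots,\langle A^p_1,\dots,A^p_{n_p}\rangle$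 are all the sequences from which $B$ is derivable with a rule of $\mathcal{I}$, then the sequences from which $B$ is derivable with a rule of $\mathcal{J}$ are exactly those of the form $\langle A^1_{j_1},\dots,A^p_{j_p}\rangle$, $1\le j_i\le n_i$. Complementation: $\mathcal{I}_{\mathcal{J}}$ is the system over sequents $\vdash A$, $\not\vdash A$ ($A\in\mathcal{S}$) containing, for each rule $f$ of $\mathcal{I}$, the rule mapping $\vdash A_1,\dots,\vdash A_n$ to $\vdash f(A_1,\dots,A_n)$, and for each rule $f$ of $\mathcal{J}$, the rule mapping $\not\vdash A_1,\dots,\not\vdash A_n$ to $\not\vdash f(A_1,\dots,A_n)$. $\mathcal{A}_{\mathcal{B}}$ is defined likewise. Automaton: given a well-founded strict order $\prec$ on $\mathcal{S}$, a rule $r$ is an introduction rule if whenever $B$ is derivable from $\langle A_1,\dots,A_n\rangle$ with $r$, then $A_i\prec B$ for all $i$. An automaton is an inference system that is finite in conclusions and contains introduction rules only. *)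

(* Defs.v *)
From Stdlib Require Import List RelationClasses.
From mathcomp Require Import all_boot.
From mathcomp Require Import boolp classical_sets functions cardinality.

Set Implicit Arguments.
Unset Strict Implicit.
Unset Printing Implicit Defensive.

Local Open Scope classical_set_scope.

(* A partial function is given by its graph, so that its domain need not be   *)
(* decidable.                                                                 *)
Record rule (S : Type) : Type := Rule {
  arity : nat;
  graph : arity.-tuple S -> S -> Prop;
  graph_functional : forall s B C, graph s B -> graph s C -> B = C
}.

Definition derivable_with (S : Type) (f : rule S) (s : seq S) (B : S) : Prop :=
  exists t : (arity f).-tuple S, s = tval t /\ graph t B.

Definition system (S : Type) : Type := set (rule S).

Definition derivable (S : Type) (I : system S) (s : seq S) (B : S) : Prop :=
  exists2 f, I f & derivable_with f s B.

Definition finite_in_conclusions (S : Type) (I : system S) : Prop :=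
  forall B, finite_set [set s | derivable I s B].

CoInductive tree (S : Type) : Type :=
  Node (B : S) (n : nat) (children : 'I_n -> tree S).

Definition label (S : Type) (t : tree S) : S := let: Node B _ _ := t in B.

CoInductive correct (S : Type) (I : system S) : tree S -> Prop :=
  CorrectNode B n (c : 'I_n -> tree S) of
    derivable I [tuple label (c i) | i < n] B
    & (forall i, correct I (c i))
  : correct I (Node B c).

(* Every node has finitely many children, so a tree has finitely many nodes   *)
(* iff it is well-founded.                                                    *)
Inductive finite_tree (S : Type) : tree S -> Prop :=
  FiniteNode B n (c : 'I_n -> tree S) of (forall i, finite_tree (c i))
  : finite_tree (Node B c).

Definition has_proof (S : Type) (I : system S) (A : S) : Prop :=
  exists t, correct I t /\ label t = A.

Definition has_finite_proof (S : Type) (I : system S) (A : S) : Prop :=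
  exists t, [/\ correct I t, finite_tree t & label t = A].

Definition equivalent (S : Type) (I J : system S) : Prop :=
  forall A, has_finite_proof I A <-> has_finite_proof J A.

(* Ss lists, without repetition, the sequences from which B is derivable with *)
(* I. The premises of J for B are ordered as Ss is, so a complement goes with *)
(* some choice of this order for each B: demanding the condition for every    *)
(* order would be contradictory as soon as <A> and <A'>, with A <> A', are    *)
(* the two elements of Ss. Forall2 (@In S) s Ss says that s has the length of *)
(* Ss and that its i-th element is an element of the i-th sequence of Ss.     *)
Definition is_complement (S : Type) (I J : system S) : Prop :=
  finite_in_conclusions J /\
  forall B, exists Ss : seq (seq S),
    [/\ List.NoDup Ss,
        forall s, List.In s Ss <-> derivable I s B
      & forall s, derivable J s B <-> List.Forall2 (@List.In S) s Ss].

Inductive sequent (S : Type) : Type :=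
  | vdash of S
  | nvdash of S.

Lemma vdash_inj (S : Type) : injective (@vdash S).
Proof. by move=> A B []. Qed.

Lemma nvdash_inj (S : Type) : injective (@nvdash S).
Proof. by move=> A B []. Qed.

Definition lift_graph (S T : Type) (g : S -> T) (f : rule S)
    (t : (arity f).-tuple T) (C : T) : Prop :=
  exists s A, [/\ t = map_tuple g s, C = g A & graph s A].

Lemma lift_graph_functional (S T : Type) (g : S -> T) (f : rule S) :
  injective g ->
  forall t B C, lift_graph g (f := f) t B -> lift_graph g t C -> B = C.
Proof.
move=> g_inj t B C [s [A [-> -> fA]]] [s' [A' [/(congr1 val) /= ess' -> fA']]].
have {ess'}/val_inj ess' : val s = val s' by exact: inj_map ess'.
by rewrite (graph_functional fA (C := A')) // ess'.
Qed.

(* The rule mapping g A_1, ..., g A_n to g (f (A_1, ..., A_n)).               *)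
Definition lift_rule (S T : Type) (g : S -> T) (g_inj : injective g)
    (f : rule S) : rule T :=
  Rule (lift_graph_functional (f := f) g_inj).

Definition complementation (S : Type) (I J : system S) : system (sequent S) :=
  lift_rule (@vdash_inj S) @` I `|` lift_rule (@nvdash_inj S) @` J.

Definition introduction_rule (S : Type) (prec : S -> S -> Prop) (f : rule S) :
    Prop :=
  forall s B, derivable_with f s B -> forall A, List.In A s -> prec A B.

Definition is_automaton (S : Type) (prec : S -> S -> Prop) (I : system S) :
    Prop :=
  finite_in_conclusions I /\ forall f, I f -> introduction_rule prec f.

(* Main.v *)
(** Finite provability is a least fixed point and possibly infinite
provability a greatest one. The premises offered by a complement [J] for [B]
are the ways of picking one premise from each sequence that derives [B] in
[I], so the operator of [J] is the De Morgan dual of that of [I]: [B] has a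
possibly infinite proof in [J] iff it has no finite proof in [I]. Each rule of
the complement of an automaton has its premises among those of the automaton,
so its conclusion is greater than its premises and all its proofs are
finite. *)

Require Import Defs.
From Stdlib Require Import List RelationClasses.
From mathcomp Require Import all_boot.
From mathcomp Require Import boolp classical_sets functions cardinality.

Set Implicit Arguments.
Unset Strict Implicit.
Unset Printing Implicit Defensive.

Local Open Scope classical_set_scope.

(** Finite provability freed from trees: the least fixed point, on which induction is direct. *)
Inductive provable (S : Type) (I : system S) : S -> Prop :=
  Provable s B of derivable I s B & (forall A, List.In A s -> provable I A)
  : provable I B.

(** The greatest fixed point, as the union of all post-fixed sets [X]: exhibiting such an [X]
    replaces corecursion. *)
Definition coprovable (S : Type) (I : system S) (A : S) : Prop :=
  exists2 X : S -> Prop, X A &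
    forall B, X B -> exists2 s, derivable I s B & forall C, List.In C s -> X C.

Lemma In_tnth (T : Type) (s : seq T) (i : 'I_(size s)) :
  List.In (tnth (in_tuple s) i) s.
Proof.
rewrite (tnth_nth (tnth (in_tuple s) i)) /=; move: (tnth _ _) => x.
case: i => /=; elim: s => //= y s IHs [|i] /=; first by left.
by move=> lt_i_s; right; exact: IHs.
Qed.

Lemma In_mktuple (T : Type) n (f : 'I_n -> T) (x : T) :
  List.In x [tuple f i | i < n] -> exists i, x = f i.
Proof. by move=> /List.in_map_iff[i [<- _]]; exists i. Qed.

Lemma mktuple_tnth (T : Type) (s : seq T) :
  [tuple tnth (in_tuple s) i | i < size s] = s :> seq T.
Proof.
rewrite -[RHS]/(tval (in_tuple s)); congr tval.
by apply: eq_from_tnth => i; rewrite tnth_mktuple.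
Qed.

(** The [match] on [t] avoids the dependent equalities between families of children that inversion
    would produce. *)
Lemma correct_inv (S : Type) (I : system S) (t : tree S) :
  correct I t ->
  let: Node B n c := t in
  derivable I [tuple label (c i) | i < n] B /\ forall i, correct I (c i).
Proof. by case. Qed.

Lemma has_finite_proofP (S : Type) (I : system S) (A : S) :
  has_finite_proof I A <-> provable I A.
Proof.
split=> [[t [tI tfin <-]]|].
  elim: tfin tI => B n c _ IHc /correct_inv[Bder cI].
  apply: (Provable Bder) => C Cs; have [i ->] := In_mktuple Cs.
  exact: IHc.
elim=> {A} s B Bder _ IHs.
have [c cP] := choice (fun i => IHs _ (In_tnth i)).
exists (Node B c); split=> //; last first.
  by constructor=> i; have [] := cP i.
constructor=> [|i]; last by have [] := cP i.
have -> : [tuple label (c i) | i < size s] = s :> seq S.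
  rewrite -[RHS]mktuple_tnth; congr tval.
  by apply: eq_from_tnth => i; rewrite !tnth_mktuple; have [] := cP i.
exact: Bder.
Qed.

(** The strategy [f] fixes the premises used for each proposition, wherever it occurs. *)
CoFixpoint unfold_tree (S : Type) (f : S -> seq S) (B : S) : tree S :=
  Node B (fun i => unfold_tree f (tnth (in_tuple (f B)) i)).

(** An identity whose [match] forces one unfolding of a cofixpoint. *)
Definition tree_id (S : Type) (t : tree S) : tree S :=
  let: Node B n c := t in Node B c.

Lemma tree_idE (S : Type) (t : tree S) : tree_id t = t.
Proof. by case: t. Qed.

Lemma unfold_treeE (S : Type) (f : S -> seq S) (B : S) :
  unfold_tree f B =
  Node B (fun i => unfold_tree f (tnth (in_tuple (f B)) i)).
Proof. exact: esym (tree_idE _). Qed.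

Lemma correct_unfold_tree (S : Type) (I : system S) (X : S -> Prop)
    (f : S -> seq S) :
  (forall B, X B -> derivable I (f B) B) ->
  (forall B, X B -> forall C, List.In C (f B) -> X C) ->
  forall B, X B -> correct I (unfold_tree f B).
Proof.
move=> f_der Xf; cofix correct_unfold => B XB; rewrite unfold_treeE.
constructor=> [|i]; first by rewrite mktuple_tnth; exact: f_der.
exact: correct_unfold (Xf _ XB _ (In_tnth i)).
Qed.

Lemma has_proofP (S : Type) (I : system S) (A : S) :
  has_proof I A <-> coprovable I A.
Proof.
split=> [[t [tI <-]]|[X XA XP]].
  exists (fun B => exists2 u, correct I u & label u = B); first by exists t.
  move=> _ [[B n c] /correct_inv[Bder cI] <-].
  exists [tuple label (c i) | i < n] => // C Cs; have [i ->] := In_mktuple Cs.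
  by exists (c i).
have /choice[f fP] : forall B, exists s,
    X B -> derivable I s B /\ forall C, List.In C s -> X C.
  (* [f] must be total; outside [X] the value [[::]] is arbitrary. *)
  move=> B; have [XB|nXB] := pselect (X B); last by exists [::].
  by have [s Bder Xs] := XP _ XB; exists s.
exists (unfold_tree f A); split=> //.
by apply: (@correct_unfold_tree _ _ X) => // B /fP[].
Qed.

Lemma provable_coprovable (S : Type) (I : system S) (A : S) :
  provable I A -> coprovable I A.
Proof.
move=> IA; exists (provable I) => // _ [s B Bder Is].
by exists s.
Qed.

(** Premises in [J] for [B] meet every sequence deriving [B] in [I], so by induction on a proof in
    [I] no post-fixed set of [J] contains its conclusion. Conversely the propositions unprovable in
    [I] form a post-fixed set of [J]: every sequence deriving one of them contains another. *)
Lemma coprovable_complement (S : Type) (I J : system S) (A : S) :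
  is_complement I J -> coprovable J A <-> ~ provable I A.
Proof.
move=> [_ IJ]; split=> [[X XA XP] IA|nIA].
  elim: IA XA => {A} s B Bder _ IHs /XP[t tder Xt].
  have [Ss [_ SsI SsJ]] := IJ B.
  have /SsI sSs := Bder; have /SsJ tSs := tder.
  have [C [Cs Ct]] : exists C, List.In C s /\ List.In C t.
    elim: tSs sSs => //= C s' t' Ss' Cs' _ IH [<-|/IH[D [Ds Dt]]].
      by exists C; split=> //; left.
    by exists D; split=> //; right.
  by apply: IHs Cs _; exact: Xt.
exists (fun B => ~ provable I B) => // B nIB.
have [Ss [_ SsI SsJ]] := IJ B.
have : forall s, List.In s Ss -> exists2 C, List.In C s & ~ provable I C.
  move=> s /SsI Bder; apply: contrapT => nC; apply: nIB.
  apply: (Provable Bder) => C Cs; apply: contrapT => nIC.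
  by apply: nC; exists C.
move=> pick.
have [t tSs tP] : exists2 t, List.Forall2 (@List.In S) t Ss &
    forall C, List.In C t -> ~ provable I C.
  (* [Ss] is a finite list, so the unprovable premises are gathered by induction on it. *)
  elim: Ss pick {SsI SsJ} => [|s Ss IHSs] pick; first by exists [::].
  have [C Cs nIC] := pick s (or_introl erefl).
  have [t tSs tP] := IHSs (fun s sSs => pick s (or_intror sSs)).
  exists (C :: t); first by constructor.
  by move=> D [<-|/tP].
by exists t => //; apply/SsJ.
Qed.

Lemma derivable_automaton_prec (S : Type) (prec : S -> S -> Prop)
    (A : system S) (s : seq S) (B C : S) :
  is_automaton prec A -> derivable A s B -> List.In C s -> prec C B.
Proof. by move=> [_ Aintro] [f Af fder]; exact: Aintro Af _ _ fder _. Qed.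

Lemma derivable_complement_prec (S : Type) (prec : S -> S -> Prop)
    (A B : system S) (s : seq S) (P C : S) :
  is_automaton prec A -> is_complement A B ->
  derivable B s P -> List.In C s -> prec C P.
Proof.
move=> Aaut [_ AB]; have [Ss [_ SsA SsB]] := AB P.
move=> /SsB sSs Cs.
have [t tSs Ct] : exists2 t, List.In t Ss & List.In C t.
  elim: sSs Cs {SsA SsB} => //= D t s' Ss' Dt _ IH [<-|/IH[u uSs Cu]].
    by exists t => //; left.
  by exists u => //; right.
by apply: derivable_automaton_prec Aaut _ Ct; apply/SsA.
Qed.

(** Premises decrease along [prec], so well-founded induction proves every element of the post-fixed
    set [X]. *)
Lemma coprovable_well_founded (S : Type) (prec : S -> S -> Prop) (I : system S)
    (A : S) :
  well_founded prec ->
  (forall s B C, derivable I s B -> List.In C s -> prec C B) ->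
  coprovable I A -> provable I A.
Proof.
move=> wf_prec Iprec [X XA XP].
elim: (wf_prec A) XA => {}A _ IHA /XP[s Ader Xs].
apply: (Provable Ader) => C Cs.
by apply: IHA (Xs _ Cs); exact: Iprec Ader Cs.
Qed.

Lemma derivable_lift (S T : Type) (g : S -> T) (g_inj : injective g)
    (I : system S) (s : seq T) (C : T) :
  derivable (lift_rule g_inj @` I) s C <->
  exists s' B, [/\ s = map g s', C = g B & derivable I s' B].
Proof.
split=> [[_ [f If <-] [t [-> [s' [B [-> -> fder]]]]]]|].
  by exists s', B; split=> //; exists f => //; exists s'.
move=> [s' [B [-> -> [f If [t [-> fder]]]]]].
exists (lift_rule g_inj f); first by exists f.
by exists (map_tuple g t); split=> //; exists t, B.
Qed.

Lemma derivableU (S : Type) (I J : system S) (s : seq S) (B : S) :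
  derivable (I `|` J) s B <-> derivable I s B \/ derivable J s B.
Proof.
split=> [[f [If|Jf] fder]|[] [f ? ?]].
- by left; exists f.
- by right; exists f.
- by exists f => //; left.
- by exists f => //; right.
Qed.

Lemma derivable_vdash (S : Type) (I J : system S) (s : seq (sequent S))
    (B : S) :
  derivable (complementation I J) s (vdash B) <->
  exists2 s', s = map (@vdash S) s' & derivable I s' B.
Proof.
rewrite derivableU !derivable_lift; split=> [[]|[s' -> Bder]].
- by move=> [s' [D [-> [->] Dder]]]; exists s'.
- by move=> [s' [? []]].
- by left; exists s', B.
Qed.

Lemma derivable_nvdash (S : Type) (I J : system S) (s : seq (sequent S))
    (B : S) :
  derivable (complementation I J) s (nvdash B) <->
  exists2 s', s = map (@nvdash S) s' & derivable J s' B.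
Proof.
rewrite derivableU !derivable_lift; split=> [[]|[s' -> Bder]].
- by move=> [s' [? []]].
- by move=> [s' [D [-> [->] Dder]]]; exists s'.
- by right; exists s', B.
Qed.

(** Read upwards, a proof of [g A] in [K] never leaves the image of [g]; this separates the two
    kinds of sequents. *)
Lemma provable_embed (S T : Type) (g : S -> T) (I : system S) (K : system T)
    (A : S) :
  (forall s B, derivable K s (g B) <->
    exists2 s', s = map g s' & derivable I s' B) ->
  provable K (g A) <-> provable I A.
Proof.
move=> KI; split=> [|].
  move gA : (g A) => C KC; elim: KC A gA => {}C.
  move=> B Bder _ IHs A gA; move: Bder; rewrite -gA => /KI[s' es Ader].
  apply: (Provable Ader) => D Ds'; apply: IHs (erefl (g D)).
  by rewrite es; apply/List.in_map_iff; exists D.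
elim=> {A} s B Bder _ IHs.
have Kder : derivable K (map g s) (g B) by apply/KI; exists s.
by apply: (Provable Kder) => _ /List.in_map_iff[D [<- /IHs]].
Qed.

Lemma coprovable_embed (S T : Type) (g : S -> T) (I : system S)
    (K : system T) (A : S) :
  (forall s B, derivable K s (g B) <->
    exists2 s', s = map g s' & derivable I s' B) ->
  coprovable K (g A) <-> coprovable I A.
Proof.
move=> KI; split=> [] [X XA XP].
  (* Post-fixed sets are transported by preimage under [g] here, and by image in the converse. *)
  exists (X \o g) => // B /XP[_ /KI[s -> Bder] Xs].
  by exists s => // C Cs; apply: Xs; apply/List.in_map_iff; exists C.
exists (fun C => exists2 B, X B & C = g B); first by exists A.
move=> _ [B /XP[s Bder Xs] ->].
exists (map g s); first by apply/KI; exists s.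
by move=> _ /List.in_map_iff[D [<- Ds]]; exists D => //; exact: Xs.
Qed.

Theorem theorem2 (S : Type) (I J : system S)
    (prec : S -> S -> Prop) (A B : system S)
    (I_fin : finite_in_conclusions I)
    (IJ : is_complement I J)
    (prec_order : StrictOrder prec)
    (prec_wf : well_founded prec)
    (A_aut : is_automaton prec A)
    (IA : equivalent I A)
    (AB : is_complement A B) :
  forall P : S,
    (has_finite_proof (complementation I J) (vdash P) <->
     has_finite_proof (complementation A B) (vdash P)) /\
    (has_proof (complementation I J) (nvdash P) <->
     has_finite_proof (complementation A B) (nvdash P)).
Proof.
move=> P; have := IA P; rewrite !has_finite_proofP => IAP.
rewrite has_proofP !(provable_embed _ (@derivable_vdash _ _ _)).
rewrite (provable_embed _ (@derivable_nvdash _ _ _)).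
rewrite (coprovable_embed _ (@derivable_nvdash _ _ _)).
(* Passing through unprovability, first in [I] and then in [A], turns coprovability in [J] into
   coprovability in [B], where proofs are finite. *)
split=> //; rewrite (coprovable_complement _ IJ) IAP.
rewrite -(coprovable_complement _ AB); split; last exact: provable_coprovable.
apply: coprovable_well_founded prec_wf _ => s Q C.
exact: derivable_complement_prec A_aut AB.
Qed.
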